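(* Let $k$ be a Mercer kernel on $\mathbb{X}=\mathbb{R}^{n_x}$ with $k\in C^4(\mathbb{X}\times\mathbb{X})$ and with corresponding reproducing kernel Hilbert space $\mathcal{H}$. Let the system dynamics be described by the controlled stochastic differential equation $$\mathrm{d}X_t=\big(f(X_t)+G(X_t)\pi(X_t)\big)\,\mathrm{d}t+\sqrt{2\epsilon}\,\mathrm{d}W_t$$ with $f\in C^1(\mathbb{X})^{n_x}$, $G\in C^1(\mathbb{X})^{n_x\times n_u}$, $\epsilon>0$, under one of the (constant) inputs $\pi\in\{0\}\cup\{e_j\}_{j\in\{1,\dots,n_u\}}$, where $e_j$ is the $j$-th standard basis vector of $\mathbb{R}^{n_u}$. Let $x^{(1)},\dots,x^{(N)}\in\mathbb{X}$ be the data points and let $K_\pi=\widehat S_\pi\widehat S^*\in\mathbb{R}^{N\times N}$ be the target kernel matrix. Then for all $i,j\in\{1,\dots,N\}$ the entries of the target kernel matrix are $$(K_\pi)_{ij}=\Big\langle f(x^{(i)})+G(x^{(i)})\pi(x^{(i)}),\ \nabla_{x^{(i)}}k(x^{(i)},x^{(j)})\Big\rangle+\epsilon\,\mathrm{Tr}\big(\nabla^2_{x^{(i)}}k(x^{(i)},x^{(j)})\big),$$ where $\nabla_{x^{(i)}}$ and $\nabla^2_{x^{(i)}}$ denote the gradient and the Hessian matrix with respect to the first argument of $k$, evaluated at $(x^{(i)},x^{(j)})$.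
   Context: A Mercer kernel is a continuous, symmetric, positive semidefinite function $k:\mathbb{X}\times\mathbb{X}\to\mathbb{R}$; its RKHS $\mathcal{H}$ has canonical feature map $\phi(x)=k(\cdot,x)\in\mathcal{H}$ and reproducing property $h(x)=\langle h,\phi(x)\rangle_{\mathcal{H}}$ for $h\in\mathcal{H}$. $W_t$ is an $n_x$-dimensional Wiener process. The Fokker-Planck-Kolmogorov (FPK) operator associated with the controlled SDE under input $\pi$ is $\mathcal{L}_\pi\rho=-\nabla\cdot\big((f+G\pi)\rho\big)+\epsilon\Delta\rho$. Its adjoint $\mathcal{L}_\pi^*$ (the backward FPK operator, i.e. the infinitesimal generator of the diffusion acting on observables) is determined on $h\in C^2(\mathbb{X})$ as the unique continuous function $\mathcal{L}_\pi^*h$ with $\int_{\mathbb{X}}(\mathcal{L}_\pi\rho)\,h\,\mathrm{d}x=\int_{\mathbb{X}}\rho\,(\mathcal{L}_\pi^*h)\,\mathrm{d}x$ for all $\rho\in C_c^\infty(\mathbb{X})$. The target feature $\psi_\pi(x)\in\mathcal{H}$ is the Riesz representer of the functional $h\mapsto(\mathcal{L}_\pi^*h)(x)$ on $\mathcal{H}$, i.e. $\langle\psi_\pi(x),h\rangle_{\mathcal{H}}=(\mathcal{L}_\pi^*h)(x)$ for all $h\in\mathcal{H}$ (for $k\in C^4$ one has $\mathcal{H}\subset C^2(\mathbb{X})$ and this functional is bounded). Data-based injection operators: $\widehat S:\mathcal{H}\to\mathbb{R}^N$, $\widehat S h=[\langle\phi(x^{(i)}),h\rangle_{\mathcal{H}}]_{i=1}^N$,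 and $\widehat S_\pi:\mathcal{H}\to\mathbb{R}^N$, $\widehat S_\pi h=[\langle\psi_\pi(x^{(i)}),h\rangle_{\mathcal{H}}]_{i=1}^N$. The adjoint of $\widehat S$ is the data-based embedding $\widehat S^*:\mathbb{R}^N\to\mathcal{H}$, $\widehat S^*w=\sum_{i=1}^N w_i\,\phi(x^{(i)})$. The target kernel matrix is $K_\pi=\widehat S_\pi\widehat S^*$. *)

(* Defs.v *)
(* Vectors of R^n are written as rows ['rV[R]_n]. *)
From HB Require Import structures.
From mathcomp Require Import all_boot all_order all_algebra.
From mathcomp Require Import all_classical all_reals all_analysis.

Set Implicit Arguments.
Unset Strict Implicit.
Unset Printing Implicit Defensive.

Import Order.TTheory GRing.Theory Num.Theory.
Import numFieldNormedType.Exports.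

Local Open Scope classical_set_scope.
Local Open Scope ring_scope.

(* The library has the product sigma-algebra on [n.-tuple T] but no Lebesgue
   measure there: [lebesgue_tuple n.+1] is the image of the product measure
   [lebesgue_measure \x lebesgue_tuple n] under [(a, t) |-> a :: t]. *)

Section cons_measure.
Context {R : realType} {n : nat}.

Definition tuple_cons (p : measurableTypeR R * n.-tuple (measurableTypeR R)) :
    n.+1.-tuple (measurableTypeR R) :=
  [the n.+1.-tuple _ of p.1 :: p.2].

Lemma measurable_tuple_cons : measurable_fun setT tuple_cons.
Proof. exact: measurable_cons. Qed.

Variable m :
  {sigma_finite_measure set (n.-tuple (measurableTypeR R)) -> \bar R}.

Definition cons_measure : set (n.+1.-tuple (measurableTypeR R)) -> \bar R :=
  pushforward (lebesgue_measure \x m)%E tuple_cons.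

Let mcons A : measurable A -> measurable (tuple_cons @^-1` A).
Proof.
by move=> mA; rewrite -[_ @^-1` _]setTI; exact: measurable_tuple_cons.
Qed.

Let cons_measure0 : cons_measure set0 = 0%E.
Proof. by rewrite /cons_measure /pushforward preimage_set0 measure0. Qed.

Let cons_measure_ge0 A : (0 <= cons_measure A)%E.
Proof. by rewrite /cons_measure /pushforward. Qed.

Let cons_measure_sigma_additive : semi_sigma_additive cons_measure.
Proof.
move=> F mF tF mUF; rewrite /cons_measure /pushforward preimage_bigcup.
apply: measure_semi_sigma_additive.
- by move=> k; exact: mcons.
- apply/trivIsetP => /= i j _ _ ij; rewrite -preimage_setI.
  by move/trivIsetP : tF => /(_ _ _ _ _ ij) ->//; rewrite preimage_set0.
- by rewrite -preimage_bigcup; exact: mcons.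
Qed.

HB.instance Definition _ := isMeasure.Build _ _ _ cons_measure
  cons_measure0 cons_measure_ge0 cons_measure_sigma_additive.

Let cons_measure_sigma_finite : sigma_finite setT cons_measure.
Proof.
have /sigma_finiteP[F [TF ndF Foo]] := sigma_finiteT (@lebesgue_measure R).
have /sigma_finiteP[G [TG ndG Goo]] := sigma_finiteT m.
pose hd (t : n.+1.-tuple (measurableTypeR R)) : measurableTypeR R := thead t.
pose tl (t : n.+1.-tuple (measurableTypeR R)) := [tuple of behead t].
exists (fun k => (hd @^-1` F k) `&` (tl @^-1` G k)).
  apply/esym; rewrite -subTset => t _.
  have [i _ Fi] : (\bigcup_i F i) (hd t) by rewrite -TF.
  have [j _ Gj] : (\bigcup_i G i) (tl t) by rewrite -TG.
  exists (maxn i j) => //; split => /=.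
    by move: (hd t) Fi; exact/subsetPset/ndF/leq_maxl.
  by move: (tl t) Gj; exact/subsetPset/ndG/leq_maxr.
move=> k; have [mF Fk] := Foo k; have [mG Gk] := Goo k; split.
  apply: measurableI; rewrite -[X in measurable X]setTI.
    exact: measurable_tnth.
  exact: measurable_behead.
rewrite /cons_measure /pushforward.
rewrite (_ : _ @^-1` _ = F k `*` G k).
  by rewrite product_measure1E// lte_mul_pinfty// ge0_fin_numE.
apply/funext => -[a t]; rewrite /preimage /setX /setI /mkset /hd /tl /=.
by rewrite (_ : [tuple of _] = t)//; apply/val_inj.
Qed.

HB.instance Definition _ := Measure_isSigmaFinite.Build _ _ _ cons_measure
  cons_measure_sigma_finite.

End cons_measure.

Fixpoint lebesgue_tuple (R : realType) (n : nat) :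
    {sigma_finite_measure set (n.-tuple (measurableTypeR R)) -> \bar R} :=
  match n with
  | 0 => \d_ ([tuple] : 0.-tuple (measurableTypeR R))
  | n'.+1 => cons_measure (lebesgue_tuple R n')
  end.

Definition integral_Rn (R : realType) (n : nat) (F : 'rV[R]_n -> R) : R :=
  \int[lebesgue_tuple R n]_t F (\row_i tnth t i).

(* Class [C^m], through iterated directional derivatives in all directions; for
   finite-dimensional [V] this is the same as through partial derivatives. *)
Fixpoint Cn (R : realType) (V : normedModType R) (m : nat) (h : V -> R) :
    Prop :=
  continuous h /\
  match m with
  | 0 => True
  | m'.+1 => forall v : V,
      (forall x, derivable h x v) /\ Cn m' (fun x => 'D_v h x)
  end.

Definition test_function (R : realType) (n : nat) (rho : 'rV[R]_n -> R) :
    Prop :=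
  (forall m, Cn m rho) /\ compact (closure [set x | rho x != 0]).

Section vector_calculus.
Context {R : realType} {n : nat}.

Definition partial (i : 'I_n) (h : 'rV[R]_n -> R) : 'rV[R]_n -> R :=
  fun x => 'D_(delta_mx 0 i) h x.

Definition grad (h : 'rV[R]_n -> R) (x : 'rV[R]_n) : 'rV[R]_n :=
  \row_i partial i h x.

Definition hess (h : 'rV[R]_n -> R) (x : 'rV[R]_n) : 'M[R]_n :=
  \matrix_(i, j) partial i (partial j h) x.

Definition divergence (F : 'rV[R]_n -> 'rV[R]_n) (x : 'rV[R]_n) : R :=
  \sum_i partial i (fun y => F y 0 i) x.

Definition laplacian (h : 'rV[R]_n -> R) : 'rV[R]_n -> R :=
  divergence (grad h).

Definition dotv (u v : 'rV[R]_n) : R := \sum_i u 0 i * v 0 i.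

End vector_calculus.

Record Mercer (R : realType) (X : topologicalType) (k : X -> X -> R) : Prop := {
  mercer_continuous : continuous (fun z : X * X => k z.1 z.2);
  mercer_sym : forall x y, k x y = k y x;
  mercer_psd : forall (m : nat) (x : 'I_m -> X) (c : 'I_m -> R),
    0 <= \sum_i \sum_j c i * c j * k (x i) (x j)
}.

(* A Hilbert space whose elements are functions on [X] through the injection
   [rkhs_eval] (linear by [rkhs_reproducing]), and which contains the functions
   [k(., x)]. *)
Record RKHS (R : realType) (X : Type) (k : X -> X -> R) := {
  rkhs_space :> completeNormedModType R;
  rkhs_ip : {dot rkhs_space for idfun};
  rkhs_norm : forall h : rkhs_space, `|h| ^+ 2 = rkhs_ip h h;
  rkhs_eval : rkhs_space -> X -> R;
  rkhs_eval_inj : injective rkhs_eval;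
  rkhs_feature : X -> rkhs_space;
  rkhs_featureE : forall x y, rkhs_eval (rkhs_feature x) y = k y x;
  rkhs_reproducing : forall (h : rkhs_space) (x : X),
    rkhs_eval h x = rkhs_ip h (rkhs_feature x)
}.

Section FPK.
Context {R : realType} {nx nu : nat}.
Local Notation X := 'rV[R]_nx.

Variables (f : X -> X) (G : X -> 'M[R]_(nx, nu)) (eps : R).
Variable (pi : X -> 'rV[R]_nu).

(* [f + G pi], transposed to row vectors. *)
Definition drift (x : X) : X := f x + pi x *m (G x)^T.

Definition FPK (rho : X -> R) (x : X) : R :=
  - divergence (fun y => rho y *: drift y) x + eps * laplacian rho x.

Definition is_adjoint_FPK (h g : X -> R) : Prop :=
  continuous g /\
  forall rho, test_function rho ->
    integral_Rn (fun x => FPK rho x * h x) = integral_Rn (fun x => rho x * g x).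

(* Definite description: for [h] of class [C^2] there is exactly one [g] with
   [is_adjoint_FPK h g], when [f], [G] are [C^1] and [pi] is constant. *)
Definition adjoint_FPK (h : X -> R) : X -> R := get (is_adjoint_FPK h).

Definition is_target_feature (k : X -> X -> R) (H : RKHS k) (psi : X -> H) :
    Prop :=
  forall (x : X) (h : H), rkhs_ip H (psi x) h = adjoint_FPK (rkhs_eval h) x.

End FPK.

Section data.
Context {R : realType} {X : Type} {k : X -> X -> R} (H : RKHS k).
Context {N : nat} (x : 'I_N -> X).

Definition injection (phi : X -> H) (h : H) : 'cV[R]_N :=
  \col_i rkhs_ip H (phi (x i)) h.

Definition embedding (w : 'cV[R]_N) : H :=
  \sum_i w i 0 *: rkhs_feature H (x i).

(* The matrix, in the standard basis, of [injection psi \o embedding]. *)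
Definition target_kernel_matrix (psi : X -> H) : 'M[R]_N :=
  \matrix_(i, j) injection psi (embedding (delta_mx j 0)) i 0.

End data.

(* Main.v *)
Require Import Defs.
From HB Require Import structures.
From mathcomp Require Import all_boot all_order all_algebra.
From mathcomp Require Import all_classical all_reals all_analysis.
From mathcomp Require Import measurable_realfun ring lra.

Set Implicit Arguments.
Unset Strict Implicit.
Unset Printing Implicit Defensive.

Import Order.TTheory GRing.Theory Num.Theory.
Import numFieldNormedType.Exports.

Local Open Scope classical_set_scope.
Local Open Scope ring_scope.

(** Pairing [psi (x i)] with [embedding (delta_mx j 0)], which is the feature of
    [x j], turns the entry of the target kernel matrix into the value at [x i]
    of [adjoint_FPK h] for [h = k(., x j)], a function of class [C^2]. As
    [adjoint_FPK h] is given by definite description, the theorem says that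
    [b . grad h + eps tr (hess h)], with [b = f + G pi], has the property that
    describes it, and that no other function has this property.

    - The formula has the property by integration by parts: once for the drift
      term, where [b] is [C^1] because [pi] is constant, and twice for the
      Laplacian. Integration by parts follows from the product rule and from
      [integral_partial]: the integral of a partial derivative of a [C^1]
      function of bounded support is zero. That is proved by induction on the
      dimension: Fubini's theorem isolates the differentiated coordinate, and
      on each line the fundamental theorem of calculus applies.

    - Only one continuous function has the property because test functions
      separate continuous functions ([test_functions_separate]). This needs
      smooth bumps supported in arbitrarily small cubes, which are products
      over the coordinates of translates and reflections of the flat function
      [exp (- 1 / x)] (zero for [x <= 0]), and the fact that cubes have
      positive measure.

    The Lebesgue measure at hand lives on tuples with the product
    sigma-algebra, whereas continuity refers to the norm of row vectors. The
    two meet in [measurable_row_open]: an open set is a countable union of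
    rational cubes. *)

(** * Functions of class C^m *)

Section smooth_functions.
Context {R : realType} {V : normedModType R}.
Implicit Types (f g : V -> R) (m : nat).

Lemma Cn_continuous m f : Cn m f -> continuous f.
Proof. by case: m => [|m] []. Qed.

Lemma Cn_derivable m f (x v : V) : Cn m.+1 f -> derivable f x v.
Proof. by case=> _ /(_ v)[]. Qed.

Lemma Cn_derive m f (v : V) : Cn m.+1 f -> Cn m (fun x => 'D_v f x).
Proof. by case=> _ /(_ v)[]. Qed.

Lemma CnW m f : Cn m.+1 f -> Cn m f.
Proof.
elim: m f => [|m IHm] f [cf df]; split => // v.
by have [dfv Cdf] := df v; split => //; exact: IHm.
Qed.

Lemma CnD m f g : Cn m f -> Cn m g -> Cn m (fun x => f x + g x).
Proof.
elim: m f g => [|m IHm] f g Cf Cg; (split;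
  first by move=> x; apply: continuousD; apply: Cn_continuous;
    eassumption) => //.
move=> v; split=> [x|]; first by apply: derivableD; apply: Cn_derivable;
  eassumption.
rewrite (_ : (fun x => _) = fun x => 'D_v f x + 'D_v g x).
  by apply: IHm; exact: Cn_derive.
by apply/funext => x; apply: deriveD; apply: Cn_derivable; eassumption.
Qed.

Lemma CnM m f g : Cn m f -> Cn m g -> Cn m (fun x => f x * g x).
Proof.
elim: m f g => [|m IHm] f g Cf Cg; (split;
  first by move=> x; apply: continuousM; apply: Cn_continuous;
    eassumption) => //.
move=> v; split=> [x|]; first by apply: derivableM; apply: Cn_derivable;
  eassumption.
rewrite (_ : (fun x => _) = fun x => f x * 'D_v g x + g x * 'D_v f x).
  by apply: CnD; apply: IHm; do [exact: CnW|exact: Cn_derive].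
by apply/funext => x; apply: deriveM; apply: Cn_derivable; eassumption.
Qed.

Lemma Cn_cst m (c : R) : Cn m (fun _ : V => c).
Proof.
elim: m c => [|m IHm] c; (split; first by move=> x; exact: cvg_cst) => // v.
split=> [x|]; first exact: derivable_cst.
have -> : (fun x => 'D_v (fun _ : V => c) x) = fun=> 0.
  by apply/funext => x; exact: derive_cst.
exact: IHm.
Qed.

Lemma Cn_sum m (I : Type) (s : seq I) (P : pred I) (F : I -> V -> R) :
  (forall i, Cn m (F i)) -> Cn m (fun x => \sum_(i <- s | P i) F i x).
Proof.
move=> CF; elim: s => [|i s IHs].
  by under [X in Cn _ X]eq_fun do rewrite big_nil; exact: Cn_cst.
under [X in Cn _ X]eq_fun do rewrite big_cons.
by case: (P i) => //; exact: CnD.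
Qed.

Lemma Cn_prod m (I : Type) (s : seq I) (P : pred I) (F : I -> V -> R) :
  (forall i, Cn m (F i)) -> Cn m (fun x => \prod_(i <- s | P i) F i x).
Proof.
move=> CF; elim: s => [|i s IHs].
  by under [X in Cn _ X]eq_fun do rewrite big_nil; exact: Cn_cst.
under [X in Cn _ X]eq_fun do rewrite big_cons.
by case: (P i) => //; exact: CnM.
Qed.

End smooth_functions.

(** Partial derivatives along slices, composition with a coordinate and
    restriction of a kernel to one argument are all instances of substituting
    an affine map; [l] is the linear part of [L]. *)
Section affine_substitution.
Context {R : realType} {V W : normedModType R} (L l : V -> W).
Hypothesis L_continuous : continuous L.
Hypothesis L_affine : forall (h : R) v x, L (h *: v + x) = h *: l v + L x.

Let quotient_affine (u : W -> R) x v :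
  (fun h : R => h^-1 *: (u (L (h *: v + x)) - u (L x))) =
  (fun h : R => h^-1 *: (u (h *: l v + L x) - u (L x))).
Proof. by apply/funext => h; rewrite L_affine. Qed.

(** The difference quotients of [u \o L] along [v] are those of [u] along
    [l v]. *)
Lemma derivable_affine (u : W -> R) x v :
  derivable u (L x) (l v) -> derivable (u \o L) x v.
Proof. by rewrite /derivable /= quotient_affine. Qed.

Lemma derive_affine (u : W -> R) x v : 'D_v (u \o L) x = 'D_(l v) u (L x).
Proof. by rewrite /derive /= quotient_affine. Qed.

Lemma Cn_affine m (u : W -> R) : Cn m u -> Cn m (u \o L).
Proof.
elim: m u => [|m IHm] u Cu; (split; first by
  move=> x; apply: continuous_comp;
    [exact: L_continuous|exact: Cn_continuous Cu _]) => //.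
move=> v; split=> [x|]; first by apply: derivable_affine; apply: Cn_derivable;
  eassumption.
rewrite (_ : (fun x => _) = (fun y => 'D_(l v) u y) \o L).
  by apply: IHm; exact: Cn_derive.
by apply/funext => x; exact: derive_affine.
Qed.

End affine_substitution.

(** * Smooth bump functions *)

Section flat_function.
Context {R : realType}.

(** The powers of [1 / x] make the family stable under differentiation up to
    linear combinations, so that smoothness is a plain induction. *)
Definition flat (n : nat) (x : R) : R :=
  if 0 < x then x^-1 ^+ n * expR (- x^-1) else 0.

Lemma flat_ge0 n x : 0 <= flat n x.
Proof.
rewrite /flat; case: ltP => // x0.
by rewrite mulr_ge0 ?expR_ge0// exprn_ge0// invr_ge0 ltW.
Qed.

Lemma flat0_gt0 x : 0 < x -> 0 < flat 0 x.
Proof. by move=> x0; rewrite /flat x0 mul1r expR_gt0. Qed.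

Lemma flat_le0 n x : x <= 0 -> flat n x = 0.
Proof. by rewrite /flat; case: ltP. Qed.

(** The exponential series dominates each of its terms, here the one of degree
    [n + 2]. The bound is of second order at [0], which gives the derivative
    there. *)
Lemma flat_le n x : flat n x <= n.+2`!%:R * x ^+ 2.
Proof.
rewrite /flat; case: ltP => [x0|_]; last by rewrite mulr_ge0 ?sqr_ge0.
have z0 : 0 < x^-1 by rewrite invr_gt0.
have := expR_ge1Dxn n.+1 (ltW z0).
set z := x^-1 in z0 * => ez.
have {}ez : z ^+ n.+2 / n.+2`!%:R <= expR z.
  by apply: le_trans ez; rewrite lerDr.
have fn0 : 0 < n.+2`!%:R :> R by rewrite ltr0n fact_gt0.
rewrite expRN ler_pdivrMr ?expR_gt0//.
have -> : z ^+ n = n.+2`!%:R * x ^+ 2 * (z ^+ n.+2 / n.+2`!%:R).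
  rewrite -addn2 exprD /z; field.
  by rewrite !gt_eqF.
by apply: ler_wpM2l ez; rewrite mulr_ge0 ?sqr_ge0// ltW.
Qed.

Lemma is_derive_flat n (x : R) :
  is_derive x 1 (flat n) (flat n.+2 x - n%:R * flat n.+1 x).
Proof.
have [x0|x0|->] := ltgtP x 0.
- rewrite !flat_le0 ?ltW// mulr0 subr0.
  apply: (near_eq_is_derive (f := cst 0)).
    near=> y; rewrite /= flat_le0// ltW//.
    by near: y; exact: lt_nbhsl.
- rewrite [flat n.+2 x]/flat [flat n.+1 x]/flat x0.
  apply: (near_eq_is_derive (f := fun y : R => y^-1 ^+ n * expR (- y^-1))).
    near=> y; rewrite /flat ifT//.
    by near: y; exact: lt_nbhsr.
  have xn0 : x != 0 by rewrite gt_eqF.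
  have dV : is_derive x 1 (fun y : R => y^-1) (- x ^- 2).
    by rewrite -[X in is_derive _ _ _ X]mulr1; exact: is_deriveV.
  have dE : is_derive x 1 (fun y : R => expR (- y^-1)) (expR (- x^-1) * x ^- 2).
    apply: (@is_derive1_comp _ expR (fun y => - y^-1)).
    by rewrite -[X in is_derive _ _ _ X]opprK; exact: is_deriveN.
  have := is_deriveM (is_deriveX n dV) dE; rewrite !fctE => /is_derive_eq;
    apply.
  rewrite /GRing.scale/= ![x^-1 ^+ _.+1]exprS !exprVn.
  case: n => [|n] /=; first by rewrite !expr0; field.
  by rewrite exprS; field; rewrite xn0 expf_neq0.
- rewrite !flat_le0// mulr0 subr0.
  set q := fun h : R => h^-1 *: (flat n (h *: 1 + 0) - flat n 0).
  suff q0 : q h @[h --> 0^'] --> 0.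
    by split; [apply/cvg_ex; exists 0|exact: cvg_lim q0].
  apply/cvgr0Pnorm_le => e e0.
  have c0 : 0 < n.+2`!%:R :> R by rewrite ltr0n fact_gt0.
  near=> h.
  have h0 : h != 0 by near: h; exact: nbhs_dnbhs_neq.
  rewrite /q addr0 (flat_le0 n (lexx 0)) subr0 [h *: 1]mulr1 normrM.
  rewrite (ger0_norm (flat_ge0 _ _)) normfV mulrC ler_pdivrMr ?normr_gt0//.
  apply: (le_trans (flat_le n h)).
  rewrite -real_normK ?num_real// expr2 mulrA ler_wpM2r// mulrC -ler_pdivlMr//.
  near: h; apply: dnbhs0_le; exact: divr_gt0.
Unshelve. all: by end_near.
Qed.

Lemma Cn_flat m n : Cn m (flat n).
Proof.
have dflat k x := @ex_derive _ _ _ _ _ _ _ (is_derive_flat k x).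
have cflat k : continuous (flat k).
  by move=> x; apply/differentiable_continuous/derivable1_diffP/dflat.
elim: m n => [|m IHm] n; split => // v; split => [x|].
  by apply/diff_derivable/derivable1_diffP/dflat.
rewrite (_ : (fun x => _) =
    fun x => v * (flat n.+2 x + - n%:R * flat n.+1 x)).
  by apply/CnM/CnD/CnM; do ?[exact: Cn_cst|exact: IHm].
apply/funext => x.
have /derivable1_diffP fd := dflat n x.
rewrite deriveE// -[in LHS](mulr1 v) -[v * 1]/(v *: 1) linearZ -deriveE//=.
by rewrite (@derive_val _ _ _ _ _ _ _ (is_derive_flat n x)) mulNr.
Qed.

End flat_function.

Section bump_function.
Context {R : realType} {n : nat}.
Implicit Types (a x : 'rV[R]_n) (r : R).

(** A product over coordinates, so that the support is a cube: the norm of row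
    vectors is the maximum norm. *)
Definition bump a r x : R :=
  \prod_i (flat 0 (x 0 i - (a 0 i - r)) * flat 0 (a 0 i + r - x 0 i)).

Lemma Cn_bump m a r : Cn m (bump a r).
Proof.
apply: Cn_prod => i; apply: CnM.
  apply: (Cn_affine (L := fun x => x 0 i - (a 0 i - r)) (l := fun v => v 0 i)).
  - move=> x; apply: (@continuousB _ _ _ (fun y : 'rV[R]_n => y 0 i));
    last exact: cst_continuous.
    exact: coord_continuous.
  - by move=> h v x; rewrite !mxE addrA.
  - exact: Cn_flat.
apply: (Cn_affine (L := fun x => a 0 i + r - x 0 i) (l := fun v => - v 0 i)).
- move=> x; apply: (@continuousB _ _ _ _ (fun y : 'rV[R]_n => y 0 i));
  first exact: cst_continuous.
  exact: coord_continuous.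
- by move=> h v x; rewrite !mxE /GRing.scale/= mulrN opprD addrCA.
- exact: Cn_flat.
Qed.

Lemma bump_ge0 a r x : 0 <= bump a r x.
Proof. by apply: prodr_ge0 => i _; rewrite mulr_ge0 ?flat_ge0. Qed.

Lemma bump_gt0 a r x : (forall i, `|x 0 i - a 0 i| < r) -> 0 < bump a r x.
Proof.
move=> xar; apply: prodr_gt0 => i _.
move: (xar i); rewrite ltr_norml => /andP[? ?].
by rewrite mulr_gt0// flat0_gt0//; lra.
Qed.

Lemma bump_neq0 a r x : bump a r x != 0 -> forall i, `|x 0 i - a 0 i| < r.
Proof.
move=> /prodf_neq0 b0 i; have := b0 i isT;
  rewrite mulf_eq0 negb_or => /andP[b1 b2].
rewrite ltr_norml; apply/andP; split.
  by move: b1; apply: contraNT; rewrite -leNgt => ?; rewrite flat_le0//; lra.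
by move: b2; apply: contraNT; rewrite -leNgt => ?; rewrite flat_le0//; lra.
Qed.

Lemma test_function_bump a r : test_function (bump a r).
Proof.
split; first by move=> m; exact: Cn_bump.
pose B := [set x : 'rV[R]_n |
  forall i, `[a 0 i - r, a 0 i + r]%classic (x 0 i)].
have cB : compact B.
  by apply: (@rV_compact R n (fun i => `[a 0 i - r, a 0 i + r]%classic)) => i;
    exact: segment_compact.
have clB : closed B by apply: compact_closed cB; exact: norm_hausdorff.
apply: (subclosed_compact _ cB); first exact: closed_closure.
rewrite [X in _ `<=` X](closure_id B).1//; apply: closureS => x /= bx i.
by have := bump_neq0 bx i; rewrite ltr_norml /= in_itv /= => /andP[? ?];
  apply/andP; split; lra.
Qed.

End bump_function.

(** * Lebesgue measure on tuples of reals *)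

Section tuple_rows.
Context {R : realType}.
Local Notation RT := (measurableTypeR R).

Definition tuple_row n (t : n.-tuple RT) : 'rV[R]_n := \row_i tnth t i.

Definition cube n (a : 'I_n -> R) (r : R) : set (n.-tuple RT) :=
  [set t | forall i, `|tnth t i - a i| <= r].

Lemma measurable_cube n (a : 'I_n -> R) (r : R) : measurable (cube a r).
Proof.
rewrite (_ : cube a r =
    \bigcap_(i in [set: 'I_n])
      [set t | `[a i - r, a i + r]%classic (tnth t i)]).
  apply: fin_bigcap_measurable => // i _.
  by rewrite -[X in measurable X]setTI; apply: measurable_tnth.
rewrite predeqE => t; split=> [tar i _ | tar i].
  by have := tar i; rewrite /= in_itv/= ler_distl.
by have := tar i I; rewrite /= in_itv/= ler_distl.
Qed.

(** Every point of [A] lies in a cube contained in [A] with rational centre and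
    radius [1 / (m + 1)], and there are countably many such cubes. *)
Lemma measurable_row_open n (A : set 'rV[R]_n) :
  open A -> measurable [set t : n.-tuple RT | A (tuple_row t)].
Proof.
move=> oA.
pose c (q : {ffun 'I_n -> rat} * nat) :=
  cube (fun i => ratr (q.1 i)) (q.2.+1%:R^-1).
pose F q := if asbool (c q `<=` [set t | A (tuple_row t)]) then c q else set0.
suff -> : [set t | A (tuple_row t)] = \bigcup_q F q.
  apply: countable_bigcupT_measurable => [|q]; first exact: countableP.
  by rewrite /F; case: asboolP => // _; exact: measurable_cube.
rewrite predeqE => t; split=> [At | [q _]]; last first.
  by rewrite /F; case: asboolP => // + tq; exact.
have /nbhs_ballP[e /= e0 eA] := oA _ At.
(* The cube has radius less than [d] and contains [t], hence has diameter less
   than [e]. *)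
pose d := e / 2.
have d0 : 0 < d by rewrite divr_gt0.
have [m _ /(_ m (leqnn m)) /= md] := near_infty_natSinv_lt (PosNum d0).
have q_ i : {q : rat | `|tnth t i - ratr q| < m.+1%:R^-1}.
  apply: cid.
  have [|q] := @rat_in_itvoo R (tnth t i - m.+1%:R^-1) (tnth t i + m.+1%:R^-1).
    by rewrite ltrBlDr -addrA ltrDl addr_gt0.
  by rewrite in_itv /= => ?; exists q; rewrite distrC ltr_distl.
pose q := ([ffun i => sval (q_ i)], m).
have ct : c q t by move=> i; rewrite ffunE; exact/ltW/(svalP (q_ i)).
exists q => //; rewrite /F; case: asboolP => // -[] s cs.
apply: eA; split=> // i j; rewrite !mxE /ball/=.
have := ct j; have := cs j; rewrite /= => h1 h2.
rewrite (_ : _ - _ = (tnth t j - ratr (q.1 j)) - (tnth s j - ratr (q.1 j)));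
  last by ring.
apply: (le_lt_trans (ler_normB _ _)).
rewrite [e](splitr e).
by apply: ltrD; [apply: le_lt_trans h2 md|apply: le_lt_trans h1 md].
Qed.

Lemma measurable_row_continuous n (F : 'rV[R]_n -> R) :
  continuous F -> measurable_fun setT (F \o @tuple_row n).
Proof.
move=> /continuousP cF;
  apply: (measurability _ (RGenOpens.measurableE R)) => //.
move=> _ [_ [a [b ->] <-]]; rewrite setTI.
apply: (@measurable_row_open n (F @^-1` `]a, b[%classic)).
by apply: cF; exact: interval_open.
Qed.

Lemma cube_cons n (a : 'I_n.+1 -> R) (r : R) :
  (@tuple_cons R n) @^-1` cube a r =
  `[a ord0 - r, a ord0 + r]%classic `*` cube (a \o lift ord0) r.
Proof.
rewrite predeqE => -[x t]; split => /= [h|[x_ar h] i].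
  split; first by have := h ord0; rewrite /= in_itv/= ler_distl.
  by move=> i; have := h (lift ord0 i); rewrite tnthS.
case: (unliftP ord0 i) => [j ->|->]; first by rewrite tnthS; exact: h.
by move: x_ar; rewrite in_itv/= ler_distl.
Qed.

Lemma lebesgue_cube n (a : 'I_n -> R) (r : R) : 0 < r ->
  lebesgue_tuple R n (cube a r) = ((r + r) ^+ n)%:E.
Proof.
move=> r0; elim: n a => [|n IHn] a /=.
  by rewrite diracE mem_set// => -[].
rewrite /cons_measure /pushforward cube_cons product_measure1E//;
  last exact: measurable_cube.
rewrite IHn exprS EFinM; congr (_ * _)%E.
rewrite [LHS]lebesgue_measure_itv /= lte_fin ifT; last first.
  by rewrite ltrBlDr -addrA ltrDl addr_gt0.
by rewrite -EFinB; congr _%:E; ring.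
Qed.

End tuple_rows.

Lemma coord_le_norm {R : realType} n (x : 'rV[R]_n) i : `|x 0 i| <= `|x|.
Proof.
by rewrite [leRHS]/Num.norm /= mx_normrE; apply/bigmax_geP; right;
  exists (0, i).
Qed.

Section bounded_support.
Context {R : realType} {n : nat}.
Implicit Types F G : 'rV[R]_n -> R.

(** Bounded support is expressed through coordinates rather than through the
    norm, so that it passes to slices by induction on the dimension. *)
Definition vanishes_beyond (M : R) F :=
  forall (x : 'rV[R]_n) i, M < `|x 0 i| -> F x = 0.

Definition integrable_Rn F :=
  (lebesgue_tuple R n).-integrable setT (EFin \o (F \o @tuple_row R n)).

(** A continuous function is bounded on the compact cube that carries it, and
    this cube has finite measure. *)
Lemma integrable_bounded_support M F : 0 < M -> continuous F ->
  vanishes_beyond M F -> integrable_Rn F.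
Proof.
move=> M0 cF vF.
pose B := cube (fun _ : 'I_n => 0) M.
have FB : EFin \o (F \o @tuple_row R n) = (EFin \o (F \o @tuple_row R n)) \_ B.
  apply/funext => t; rewrite patchE; case: ifPn => // tB.
  have /existsNP[i /negP] : ~ B t by move=> h; rewrite mem_set in tB.
  rewrite subr0 -ltNge => Mt /=.
  by rewrite (vF _ i)// mxE.
have mF := measurable_row_continuous cF.
have mB : measurable B by exact: measurable_cube.
rewrite /integrable_Rn FB; apply: (proj1 (integrable_mkcond _ mB)).
apply: measurable_bounded_integrable.
- exact: mB.
- by rewrite [ltLHS](lebesgue_cube _ M0) ltry.
- exact: measurable_funTS mF.
- have cB : compact [set x : 'rV[R]_n | forall i, `[- M, M]%classic (x 0 i)].
    apply: (@rV_compact R n (fun=> `[- M, M]%classic)) => _;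
      exact: segment_compact.
  have := continuous_compact (continuous_subspaceT cF) cB.
  move=> /compact_bounded[K [_ FK]]; exists K; split; first exact: num_real.
  move=> y Ky t Bt; apply: FK => //=; exists (tuple_row t) => // i.
  by have := Bt i; rewrite subr0 mxE /= in_itv/= ler_norml.
Qed.

Lemma test_function_vanishes F : test_function F ->
  exists2 M, 0 < M & vanishes_beyond M F.
Proof.
case=> _ /compact_bounded[K [_ FK]].
exists (`|K| + 2) => [|x i Mx]; first by rewrite ltr_wpDl.
apply/eqP; apply: contraTT (Mx) => Fx; rewrite -leNgt.
apply: (le_trans (coord_le_norm x i)).
have /FK xK : K < `|K| + 2 by rewrite (le_lt_trans (ler_norm K))// ltrDl.
by apply: xK; exact: subset_closure.
Qed.

End bounded_support.

(** * Integrals of partial derivatives *)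

Section cons_row.
Context {R : realType} {n : nat}.
Implicit Types (a : R) (x : 'rV[R]_n).

Definition cons_row a x : 'rV[R]_n.+1 :=
  \row_i oapp (fun j => x 0 j) a (unlift ord0 i).

Lemma cons_row0 a x : cons_row a x 0 ord0 = a.
Proof. by rewrite mxE unlift_none. Qed.

Lemma cons_rowS a x i : cons_row a x 0 (lift ord0 i) = x 0 i.
Proof. by rewrite mxE liftK. Qed.

Lemma cons_row_affine (h : R) b v a x :
  cons_row (h * b + a) (h *: v + x) = h *: cons_row b v + cons_row a x.
Proof.
by apply/rowP => i; rewrite !mxE; case: (unliftP ord0 i) => [j _|_] /=;
  rewrite ?mxE.
Qed.

Lemma cons_row_continuousl a : continuous (cons_row a).
Proof.
move=> x A /nbhs_ballP[e /= e0 eA]; apply/nbhs_ballP; exists e => //= y [_ xy].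
apply: eA; split=> // i j; rewrite !mxE.
by case: (unliftP ord0 j) => [k _|_] /=; [exact: xy|exact: ballxx].
Qed.

Lemma cons_row_continuousr x : continuous (cons_row ^~ x).
Proof.
move=> a A /nbhs_ballP[e /= e0 eA]; apply/nbhs_ballP; exists e => //= b ab.
apply: eA; split=> // i j; rewrite !mxE.
by case: (unliftP ord0 j) => [k _|_] //=; exact: ballxx.
Qed.

Lemma cons_row10 : cons_row 1 0 = delta_mx 0 ord0.
Proof.
by apply/rowP => i; rewrite !mxE; case: (unliftP ord0 i) => [j ->|->] /=;
  rewrite ?mxE.
Qed.

Lemma cons_row0_delta i : cons_row 0 (delta_mx 0 i) = delta_mx 0 (lift ord0 i).
Proof.
by apply/rowP => j; rewrite !mxE; case: (unliftP ord0 j) => [k ->|->] /=;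
  rewrite ?mxE.
Qed.

Lemma tuple_row_cons (p : measurableTypeR R * n.-tuple (measurableTypeR R)) :
  tuple_row (tuple_cons p) = cons_row p.1 (tuple_row p.2).
Proof.
by apply/rowP => i; rewrite !mxE; case: (unliftP ord0 i) => [j ->|->] /=;
  rewrite ?mxE ?tnthS.
Qed.

Section slices.
Variable F : 'rV[R]_n.+1 -> R.

Lemma Cn_slicel m a : Cn m F -> Cn m (F \o cons_row a).
Proof.
apply: (Cn_affine (l := cons_row 0)); first exact: cons_row_continuousl.
by move=> h v x; rewrite -cons_row_affine mulr0 add0r.
Qed.

Lemma Cn_slicer m x : Cn m F -> Cn m (F \o cons_row ^~ x).
Proof.
apply: (Cn_affine (l := cons_row ^~ 0)); first exact: cons_row_continuousr.
by move=> h v a; rewrite -cons_row_affine scaler0 add0r.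
Qed.

Lemma partial_slicel a x i :
  partial i (F \o cons_row a) x = partial (lift ord0 i) F (cons_row a x).
Proof.
rewrite /partial (derive_affine (l := cons_row 0)) ?cons_row0_delta//.
by move=> h v y; rewrite -cons_row_affine mulr0 add0r.
Qed.

(** The direction [1] on the line is sent by [cons_row ^~ 0] to the first basis
    vector. *)
Lemma derive_slicer a x :
  'D_1 (F \o cons_row ^~ x) a = partial ord0 F (cons_row a x).
Proof.
rewrite /partial -cons_row10 (derive_affine (l := cons_row ^~ 0))//.
by move=> h v y; rewrite -cons_row_affine scaler0 add0r.
Qed.

End slices.
End cons_row.

Section iterated_integral.
Context {R : realType} {n : nat} (F : 'rV[R]_n.+1 -> R).
Hypothesis iF : integrable_Rn F.
Local Notation m := (lebesgue_tuple R n).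
Local Notation g := (EFin \o (F \o @tuple_row R n.+1)).

Let integrable_cons :
  (lebesgue_measure \x m)%E.-integrable setT (g \o @tuple_cons R n).
Proof.
have /integrableP[mg ig] := iF.
apply/integrableP; split.
  apply/measurable_EFinP; have /measurable_EFinP mF := mg.
  exact: (measurableT_comp mF (@measurable_tuple_cons R n)).
move: ig; rewrite [X in (X < _)%E](ge0_integral_pushforward
  (@measurable_tuple_cons R n))//.
exact: measurableT_comp.
Qed.

Let integral_cons : (\int[lebesgue_tuple R n.+1]_t (F (tuple_row t))%:E =
  \int[lebesgue_measure \x m]_p (g \o @tuple_cons R n) p)%E.
Proof.
have /integrableP[mg _] := iF.
exact: (integral_pushforward (@measurable_tuple_cons R n) mg integrable_cons).
Qed.

(** The measure on tuples of length [n + 1] is the image of a product measure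
    under [tuple_cons], so both orders of integration are available. *)
Lemma iterated_integral_tail :
  (\int[lebesgue_tuple R n.+1]_t (F (tuple_row t))%:E =
  \int[lebesgue_measure]_a \int[m]_t (F (cons_row a (tuple_row t)))%:E)%E.
Proof.
rewrite integral_cons.
apply: (etrans (esym (integral12_prod_meas1 integrable_cons))).
by apply: eq_integral => a _; apply: eq_integral => t _ /=;
  rewrite tuple_row_cons.
Qed.

Lemma iterated_integral_head :
  (\int[lebesgue_tuple R n.+1]_t (F (tuple_row t))%:E =
  \int[m]_t \int[lebesgue_measure]_a (F (cons_row a (tuple_row t)))%:E)%E.
Proof.
rewrite integral_cons.
apply: (etrans (esym (integral21_prod_meas1 integrable_cons))).
by apply: eq_integral => t _; apply: eq_integral => a _ /=;
  rewrite tuple_row_cons.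
Qed.

End iterated_integral.

Section integral_of_derivatives.
Context {R : realType}.

Lemma derive_zero_near (V : normedModType R) (F : V -> R) x v :
  (\forall y \near x, F y = 0) -> 'D_v F x = 0.
Proof. by move=> F0; rewrite (near_eq_derive (g := cst 0))// derive_cst. Qed.

Lemma vanishes_beyond_derive n (F : 'rV[R]_n -> R) M v :
  vanishes_beyond M F -> vanishes_beyond M (fun x => 'D_v F x).
Proof.
move=> vF x i Mx; apply: derive_zero_near; near=> y; apply: (vF _ i).
near: y; exact: (@cvgr_norm_gt R R _ (nbhs x) _
  (fun y : 'rV[R]_n => y 0 i) (x 0 i) (@coord_continuous R 1 n 0 i x) M Mx).
Unshelve. all: by end_near. Qed.

(** By the fundamental theorem of calculus on [[- (M + 1), M + 1]]: the margin
    [1] puts both ends in the region where [u] is assumed to vanish. *)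
Lemma integral_derive_line (u : R -> R) M : 0 < M -> Cn 1 u ->
  (forall a, M < `|a| -> u a = 0) ->
  (\int[lebesgue_measure]_a ('D_1 u a)%:E = 0)%E.
Proof.
move=> M0 Cu u0.
pose D : set R := `[- (M + 1), M + 1]%classic.
rewrite (_ : (fun a => ('D_1 u a)%:E) = (fun a => ('D_1 u a)%:E) \_ D);
  last first.
  apply/funext => a; rewrite patchE; case: ifPn => // /negP aD; congr EFin.
  have Ma : M < `|a|.
    rewrite ltNge; apply/negP => aM; apply: aD;
      rewrite inE /D /= in_itv/= -ler_norml.
    by rewrite (le_trans aM)// lerDl.
  apply: derive_zero_near; near=> b; apply: u0.
  near: b; exact: (@cvgr_norm_gt R R R (nbhs a) _ id a cvg_id M Ma).
have M1 : M < `|M + 1| by rewrite ger0_norm ?ltrDl// addr_ge0// ltW.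
have uC := Cn_continuous Cu.
rewrite -integral_mkcond (@continuous_FTC2 _ (fun a => 'D_1 u a) u).
- by rewrite !u0 ?subee ?normrN.
- by rewrite -subr_gt0 opprK; rewrite !addr_gt0.
- by apply: continuous_subspaceT; have /Cn_continuous := Cn_derive (1 : R) Cu.
- split=> [a _||]; first by apply: Cn_derivable; exact: Cu.
    by apply: cvg_at_right_filter; exact: uC.
  by apply: cvg_at_left_filter; exact: uC.
- by move=> a _; rewrite derive1E.
Unshelve. all: by end_near. Qed.

(** Fubini's theorem allows the differentiated coordinate to be integrated
    first: if it is the first one, the inner integral is zero by the
    one-dimensional case, otherwise by induction. *)
Lemma integral_partial n (i : 'I_n) (F : 'rV[R]_n -> R) M : 0 < M -> Cn 1 F ->
  vanishes_beyond M F ->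
  (\int[lebesgue_tuple R n]_t (partial i F (tuple_row t))%:E = 0)%E.
Proof.
elim: n i F => [[]//|n IHn] i F M0 CF vF.
have iF : integrable_Rn (partial i F).
  apply: (integrable_bounded_support M0).
    exact: (Cn_continuous (Cn_derive _ CF)).
  exact: vanishes_beyond_derive.
have [j ij|ij] := unliftP ord0 i.
  rewrite (iterated_integral_tail iF) integral0_eq// => a _.
  have vFa : vanishes_beyond M (F \o cons_row a).
    by move=> x k; rewrite -(cons_rowS a x) => /vF.
  rewrite -[RHS](IHn j _ M0 (Cn_slicel a CF) vFa).
  by apply: eq_integral => t _; rewrite ij partial_slicel.
rewrite (iterated_integral_head iF) integral0_eq// => t _.
have vFt a : M < `|a| -> (F \o cons_row ^~ (tuple_row t)) a = 0.
  by rewrite -[a in `|a|](cons_row0 a (tuple_row t)) => /vF.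
rewrite -[RHS](integral_derive_line M0 (Cn_slicer (tuple_row t) CF) vFt).
by apply: eq_integral => a _; rewrite ij derive_slicer.
Qed.

End integral_of_derivatives.

(** * Integration by parts *)

Section compact_support.
Context {R : realType} {n : nat}.
Implicit Types F G : 'rV[R]_n -> R.

(** The usual space of continuous functions of compact support; integration is
    linear on it. *)
Definition Cc F := continuous F /\ exists2 M, 0 < M & vanishes_beyond M F.

Lemma Cc_test rho : test_function rho -> Cc rho.
Proof.
move=> rhoT; split; first exact: Cn_continuous (rhoT.1 0).
exact: test_function_vanishes.
Qed.

Lemma Cc_integrable F : Cc F -> integrable_Rn F.
Proof. by move=> [cF [M M0 vF]]; exact: integrable_bounded_support vF. Qed.

Lemma CcMr F G : Cc F -> continuous G -> Cc (fun x => F x * G x).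
Proof.
move=> [cF [M M0 vF]] cG; split.
  by move=> x; apply: continuousM; [exact: cF|exact: cG].
by exists M => // x i Mx; rewrite (vF x i Mx) mul0r.
Qed.

Lemma CcZ c F : Cc F -> Cc (fun x => c * F x).
Proof.
move=> cF; under [X in Cc X]eq_fun do rewrite mulrC.
by apply: CcMr => // x; exact: cst_continuous.
Qed.

Lemma CcD F G : Cc F -> Cc G -> Cc (fun x => F x + G x).
Proof.
move=> [cF [M M0 vF]] [cG [N N0 vG]]; split.
  by move=> x; apply: continuousD; [exact: cF|exact: cG].
exists (M + N) => [|x i MNx]; first exact: addr_gt0.
by rewrite (vF _ i) ?(vG _ i) ?addr0//; apply: lt_trans MNx;
  rewrite ?ltrDl ?ltrDr.
Qed.

Lemma Cc_sum (s : seq 'I_n) (F : 'I_n -> 'rV[R]_n -> R) :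
  (forall i, Cc (F i)) -> Cc (fun x => \sum_(i <- s) F i x).
Proof.
move=> cF; elim: s => [|i s IHs].
  under [X in Cc X]eq_fun do rewrite big_nil.
  by split; [exact: cst_continuous|exists 1].
by under [X in Cc X]eq_fun do rewrite big_cons; exact: CcD.
Qed.

Lemma Cc_partial i F : Cn 1 F -> Cc F -> Cc (partial i F).
Proof.
move=> CF [_ [M M0 vF]]; split; first exact: Cn_continuous (Cn_derive _ CF).
by exists M => //; exact: vanishes_beyond_derive.
Qed.

Lemma integral_RnD F G : Cc F -> Cc G ->
  integral_Rn (fun x => F x + G x) = integral_Rn F + integral_Rn G.
Proof. by move=> /Cc_integrable iF /Cc_integrable iG; exact: RintegralD. Qed.

Lemma integral_RnZ c F : Cc F ->
  integral_Rn (fun x => c * F x) = c * integral_Rn F.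
Proof. by move=> /Cc_integrable iF; exact: RintegralZl. Qed.

Lemma integral_Rn_sum (s : seq 'I_n) (F : 'I_n -> 'rV[R]_n -> R) :
  (forall i, Cc (F i)) ->
  integral_Rn (fun x => \sum_(i <- s) F i x) = \sum_(i <- s) integral_Rn (F i).
Proof.
move=> cF; elim: s => [|i s IHs].
  under [X in integral_Rn X]eq_fun do rewrite big_nil.
  by rewrite big_nil /integral_Rn /Rintegral integral0.
under [X in integral_Rn X]eq_fun do rewrite big_cons.
by rewrite big_cons integral_RnD ?IHs//; exact: Cc_sum.
Qed.

(** The sum of the two integrands is the partial derivative of [F * G]. *)
Lemma integral_by_parts i F G : Cc F -> Cn 1 F -> Cn 1 G ->
  integral_Rn (fun x => partial i F x * G x) =
  - integral_Rn (fun x => F x * partial i G x).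
Proof.
move=> cF CF CG; apply/eqP; rewrite -subr_eq0 opprK -integral_RnD; last 2 first.
- by apply: CcMr; [exact: Cc_partial|exact: Cn_continuous CG].
- by apply: CcMr => //; exact: Cn_continuous (Cn_derive _ CG).
have -> : (fun x => partial i F x * G x + F x * partial i G x) =
    partial i (fun x => F x * G x).
  apply/funext => x; rewrite /partial.
  rewrite [RHS](deriveM (Cn_derivable CF) (Cn_derivable CG)).
  by rewrite addrC /GRing.scale/= [G x * _]mulrC.
have [_ [M M0 vFG]] := CcMr cF (Cn_continuous CG).
by rewrite /integral_Rn /Rintegral (integral_partial i M0 (CnM CF CG) vFG).
Qed.

End compact_support.

(** * Test functions separate continuous functions *)

Section separation.
Context {R : realType} {n : nat}.

(** If [g a > 0], then [g > 0] on a cube around [a], and a bump [rho] supported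
    there makes [rho * g] nonnegative with integral zero, hence zero almost
    everywhere. But [rho * g] is positive on a smaller cube, which has positive
    measure. *)
Lemma test_functions_le0 (g : 'rV[R]_n -> R) : continuous g ->
  (forall rho, test_function rho -> integral_Rn (fun x => rho x * g x) = 0) ->
  forall a, g a <= 0.
Proof.
move=> cg g0 a; rewrite leNgt; apply/negP => ga.
have [e e0 ge] : exists2 e : R, 0 < e &
    forall x : 'rV[R]_n, (forall i, `|x 0 i - a 0 i| < e) -> 0 < g x.
  have /nbhs_ballP[e /= e0 eg] := cg a _ (lt_nbhsr ga).
  exists e => // x xa; apply: eg; split=> // i j.
  by rewrite ord1 /ball /= distrC.
(* Outside the cube where [g] is positive the bump is zero. *)
have ge0 x : 0 <= bump a e x * g x.
  have [->|/bump_neq0 xa] := eqVneq (bump a e x) 0; first by rewrite mul0r.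
  by rewrite mulr_ge0 ?bump_ge0// ltW// ge.
have rhoT := test_function_bump a e.
have /Cc_integrable iF := CcMr (Cc_test rhoT) cg.
set F := fun x => bump a e x * g x in iF.
have F0 : (\int[lebesgue_tuple R n]_t `|(F (tuple_row t))%:E| = 0)%E.
  under eq_integral do rewrite gee0_abs ?lee_fin ?ge0//.
  rewrite -[LHS]fineK; last exact: integrable_fin_num.
  by congr _%:E; exact: g0 rhoT.
have mF := measurable_int _ iF.
have [N [mN N0 FN]] := (ae_eq_integral_abs _ measurableT mF).1 F0.
have e2 : 0 < e / 2 by rewrite divr_gt0.
pose C := @cube R n (fun i => a 0 i) (e / 2).
have CN : C `<=` N.
  move=> t tC; apply: FN => /(_ I) /= -[] /eqP; apply/negP; rewrite gt_eqF//.
  have ta i : `|tuple_row t 0 i - a 0 i| < e.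
    by rewrite mxE (le_lt_trans (tC i))// ltr_pdivrMr// ltr_pMr// ltr1n.
  by rewrite mulr_gt0 ?bump_gt0 ?ge.
have mC : measurable C by exact: measurable_cube.
have : (lebesgue_tuple R n C <= 0)%E by rewrite -[leRHS]N0 le_measure ?inE.
by rewrite leNgt [ltRHS](lebesgue_cube _ e2) lte_fin exprn_gt0// addr_gt0.
Qed.

Lemma test_functions_separate (g1 g2 : 'rV[R]_n -> R) :
  continuous g1 -> continuous g2 ->
  (forall rho, test_function rho ->
    integral_Rn (fun x => rho x * g1 x) =
    integral_Rn (fun x => rho x * g2 x)) ->
  g1 = g2.
Proof.
move=> c1 c2 g12.
have le u v (cu : continuous u) (cv : continuous v) :
    (forall rho, test_function rho ->
      integral_Rn (fun x => rho x * u x) =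
      integral_Rn (fun x => rho x * v x)) ->
    forall a : 'rV[R]_n, u a <= v a.
  move=> uv a; rewrite -subr_le0 -mulN1r.
  apply: (test_functions_le0 (g := fun x => u x + -1 * v x)) => [x|rho rhoT].
    apply: (@continuousD _ _ _ u (fun y => -1 * v y)); first exact: cu.
    by apply: (@continuousM _ _ (cst (-1)) v);
      [exact: cst_continuous|exact: cv].
  have crho := Cc_test rhoT.
  under [X in integral_Rn X]eq_fun do rewrite mulrDr mulrCA.
  rewrite integral_RnD ?integral_RnZ ?uv ?mulN1r ?subrr//; try exact: CcMr.
  by apply: CcZ; exact: CcMr.
apply/funext => a; apply/eqP; rewrite eq_le !le// => rho rhoT.
by rewrite g12.
Qed.

End separation.

(** * The backward operator *)

Section backward_operator.
Context {R : realType} {nx nu : nat}.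
Variables (f : 'rV[R]_nx -> 'rV[R]_nx) (G : 'rV[R]_nx -> 'M[R]_(nx, nu)).
Variables (eps : R) (pi : 'rV[R]_nx -> 'rV[R]_nu).

Definition backward_FPK (h : 'rV[R]_nx -> R) (x : 'rV[R]_nx) : R :=
  dotv (drift f G pi x) (grad h x) + eps * \tr (hess h x).

(** Both operators are written as sums over coordinates, whose terms are matched
    one by one by integration by parts. *)
Lemma FPKE rho x : FPK f G eps pi rho x =
  \sum_i (-1 * partial i (fun y => rho y * drift f G pi y 0 i) x
          + eps * partial i (partial i rho) x).
Proof.
rewrite /FPK /laplacian /divergence -[X in X + _]mulN1r !mulr_sumr -big_split.
rewrite /=.
apply: eq_bigr => i _; congr (_ * partial i _ x + _ * partial i _ x).
  by apply/funext => y; rewrite mxE.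
by apply/funext => y; rewrite mxE.
Qed.

Lemma backward_FPKE h : backward_FPK h = fun x =>
  \sum_i (drift f G pi x 0 i * partial i h x + eps * partial i (partial i h) x).
Proof.
apply/funext => x; rewrite /backward_FPK /dotv /mxtrace mulr_sumr -big_split /=.
by apply: eq_bigr => i _; rewrite !mxE.
Qed.

Hypothesis drift_C1 : forall i, Cn 1 (fun x => drift f G pi x 0 i).

Lemma backward_FPK_continuous h : Cn 2 h -> continuous (backward_FPK h).
Proof.
move=> Ch; suff /Cn_continuous : Cn 0 (backward_FPK h) by [].
rewrite backward_FPKE.
apply: Cn_sum => i; apply: CnD; apply: CnM; first exact: CnW.
- exact/CnW/Cn_derive.
- exact: Cn_cst.
- exact/Cn_derive/Cn_derive.
Qed.

Lemma is_adjoint_backward_FPK h : Cn 2 h ->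
  is_adjoint_FPK f G eps pi h (backward_FPK h).
Proof.
move=> Ch; split; first exact: backward_FPK_continuous.
move=> rho rhoT.
have crho := Cc_test rhoT.
have ch := Cn_continuous Ch.
have Crho m : Cn m rho := rhoT.1 m.
have Ch1 : Cn 1 h := CnW Ch.
have Cdh i : Cn 1 (partial i h) := Cn_derive _ Ch.
have Cdrho m i : Cn m (partial i rho) := Cn_derive _ (Crho m.+1).
have Crb i : Cn 1 (fun y => rho y * drift f G pi y 0 i) by exact: CnM.
have crb i : Cc (fun y => rho y * drift f G pi y 0 i).
  by apply: CcMr => //; exact: Cn_continuous (drift_C1 i).
have cdrho i : Cc (partial i rho) by exact: Cc_partial.
transitivity (\sum_i
  (-1 * integral_Rn (fun x =>
          partial i (fun y => rho y * drift f G pi y 0 i) x * h x)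
   + eps * integral_Rn (fun x => partial i (partial i rho) x * h x))).
  under [X in integral_Rn X]eq_fun do rewrite FPKE mulr_suml.
  rewrite integral_Rn_sum => [|i].
    apply: eq_bigr => i _.
    under [X in integral_Rn X]eq_fun do rewrite mulrDl -!mulrA.
    have cA : Cc (fun y =>
        partial i (fun y => rho y * drift f G pi y 0 i) y * h y).
      by apply: CcMr ch; exact: Cc_partial.
    have cB : Cc (fun y => partial i (partial i rho) y * h y).
      by apply: CcMr ch; exact: Cc_partial.
    by rewrite (integral_RnD (CcZ _ cA) (CcZ _ cB)) (integral_RnZ _ cA)
      (integral_RnZ _ cB).
  by apply: CcMr => //; apply: CcD; apply: CcZ; exact: Cc_partial.
(* One integration by parts for the drift term, two for the second-order one. *)
transitivity (\sum_i
  (integral_Rn (fun x => rho x * drift f G pi x 0 i * partial i h x)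
   + eps * integral_Rn (fun x => rho x * partial i (partial i h) x))).
  apply: eq_bigr => i _.
  rewrite (integral_by_parts _ (crb i) (Crb i) Ch1) mulN1r opprK.
  rewrite (integral_by_parts _ (cdrho i) (Cdrho 1 i) Ch1).
  by rewrite (integral_by_parts _ crho (Crho 1) (Cdh i)) opprK.
under [X in _ = integral_Rn X]eq_fun do rewrite backward_FPKE mulr_sumr.
have cdh i : continuous (partial i h) := Cn_continuous (Cdh i).
have cddh i : continuous (partial i (partial i h)) :=
  Cn_continuous (Cn_derive _ (Cdh i)).
rewrite integral_Rn_sum => [|i].
  apply: eq_bigr => i _.
  under [X in _ = integral_Rn X]eq_fun do rewrite mulrDr mulrA mulrCA.
  by rewrite integral_RnD ?integral_RnZ//; do ?apply: CcZ; exact: CcMr.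
under [X in Cc X]eq_fun do rewrite mulrDr mulrA mulrCA.
by apply: CcD; do ?apply: CcZ; exact: CcMr.
Qed.

(** Both requirements of the definite description are at hand: existence from
    integration by parts, uniqueness from the separation property. *)
Lemma adjoint_FPK_backward h : Cn 2 h ->
  adjoint_FPK f G eps pi h = backward_FPK h.
Proof.
move=> Ch; have [cL adjL] := is_adjoint_backward_FPK Ch.
apply: get_subset1 => // g1 g2 [c1 adj1] [c2 adj2].
by apply: test_functions_separate => // rho rhoT; rewrite -adj1// adj2.
Qed.

End backward_operator.

Theorem lemma1 (R : realType) (nx nu N : nat)
    (k : 'rV[R]_nx -> 'rV[R]_nx -> R)
    (k_mercer : Mercer k)
    (k_C4 : Cn 4 (fun z : 'rV[R]_nx * 'rV[R]_nx => k z.1 z.2))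
    (H : RKHS k)
    (f : 'rV[R]_nx -> 'rV[R]_nx)
    (f_C1 : forall i, Cn 1 (fun x => f x 0 i))
    (G : 'rV[R]_nx -> 'M[R]_(nx, nu))
    (G_C1 : forall i j, Cn 1 (fun x => G x i j))
    (eps : R) (eps_gt0 : 0 < eps)
    (pi : 'rV[R]_nx -> 'rV[R]_nu)
    (pi_input : pi = (fun _ => 0) \/ exists j, pi = (fun _ => delta_mx 0 j))
    (psi : 'rV[R]_nx -> H)
    (psi_target : is_target_feature f G eps pi psi)
    (x : 'I_N -> 'rV[R]_nx) (i j : 'I_N) :
  target_kernel_matrix x psi i j =
    dotv (f (x i) + pi (x i) *m (G (x i))^T) (grad (fun y => k y (x j)) (x i))
    + eps * \tr (hess (fun y => k y (x j)) (x i)).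
Proof.
have [c pi_c] : exists c, pi = fun=> c by case: pi_input => [->|[l ->]];
  eexists.
have drift_C1 l : Cn 1 (fun y => drift f G pi y 0 l).
  rewrite pi_c; under [X in Cn _ X]eq_fun do rewrite !mxE.
  apply: CnD => //; apply: Cn_sum => m; apply: CnM; first exact: Cn_cst.
  by under [X in Cn _ X]eq_fun do rewrite mxE.
have k_C2 : Cn 2 (fun y => k y (x j)).
  apply: (@Cn_affine R _ _ (fun y => (y, x j)) (fun v => (v, 0)) _ _ 2
    (fun z => k z.1 z.2)); last exact/CnW/CnW.
    by move=> y; exact: (cvg_pair (cvg_id (F := nbhs y)) (cvg_cst (x j))).
  by move=> h v y; congr pair; rewrite -[LHS]add0r -[X in X + _](scaler0 _ h).
rewrite !mxE (_ : embedding _ _ _ = rkhs_feature H (x j)); last first.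
  rewrite /embedding (bigD1 j)//= big1 => [|l /negPf lj];
    rewrite mxE ?lj ?scale0r//.
  by rewrite !eqxx scale1r addr0.
rewrite psi_target (_ : rkhs_eval _ = fun y => k y (x j)).
  by rewrite adjoint_FPK_backward.
by apply/funext => y; rewrite rkhs_featureE.
Qed.
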